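(* Let $\mathscr{P}=(A,B,C)$ be a linear time-invariant system with $A\in\mathbb{R}^{n\times n}$, $B\in\mathbb{R}^{n\times m}$, $C\in\mathbb{R}^{q\times n}$, and let $N>1$. If $N$ is odd, then $\mathscr{P}^N$ is output-feedback synchronizable if and only if the following three conditions hold: (i) $(A,B)$ is stabilizable; (ii) $(A,C)$ is detectable; (iii) there exist a real matrix $K\in\mathbb{R}^{m\times q}$, a complex number $s$, and a Hermitian positive-semidefinite matrix $P\in\mathbb{C}^{n\times n}$ such that $$(A-sBKC)^*P+P(A-sBKC)+C^TC+C^TK^TKC=0.$$
   Context: Graphs: $\mathcal{G}^N$ is the set of directed weighted graphs on nodes $\{1,\dots,N\}$ given by a weighted adjacency matrix $\Sigma=(\sigma_{i,j})\in\mathbb{R}^{N\times N}$ with $\sigma_{i,i}=0$ for all $i$ ($(i,j)$ is an edge iff $\sigma_{i,j}\neq0$). Weights may be negative and $\Sigma$ need not be symmetric. Network: for $K\in\mathbb{R}^{m\times q}$ and $\mathscr{G}\in\mathcal{G}^N$, the network $(\mathscr{P}^N,K,\mathscr{G})$ consists of $N$ copies of the system, $\dot x_i=Ax_i+Bu_i$, $y_i=Cx_i$, $x_i\in\mathbb{R}^n$, $u_i\in\mathbb{R}^m$, $y_i\in\mathbb{R}^q$, $i=1,\dots,N$, coupled by $u_i=K\sum_{j=1}^N\sigma_{i,j}(y_j-y_i)$. It is said to synchronize if $\lim_{t\to\infty}(x_i(t)-x_j(t))=0$ for all $i,j$ and all initial conditions. The collection $\mathscr{P}^N$ ($N$ copies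 of $\mathscr{P}$) is output-feedback synchronizable (OFS) if there exist $K\in\mathbb{R}^{m\times q}$ and $\mathscr{G}\in\mathcal{G}^N$ such that $(\mathscr{P}^N,K,\mathscr{G})$ synchronizes. $M^*$ denotes the conjugate transpose and $M^T$ the transpose of $M$. Stabilizable and detectable have their usual meaning in continuous time: $(A,B)$ is stabilizable if $A-BF$ is Hurwitz (all eigenvalues have strictly negative real part) for some real $F$; $(A,C)$ is detectable if $(A^T,C^T)$ is stabilizable. *)

(* Defs.v *)
From HB Require Import structures.
From mathcomp Require Import all_boot all_order all_algebra.
From mathcomp Require Import all_classical all_reals all_analysis.
From mathcomp Require Import complex.
Import Order.TTheory GRing.Theory Num.Theory.
Import numFieldNormedType.Exports.

Set Implicit Arguments.
Unset Strict Implicit.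
Unset Printing Implicit Defensive.

Local Open Scope classical_set_scope.
Local Open Scope ring_scope.
Local Open Scope complex_scope.
Local Open Scope sesquilinear_scope.

Definition complexify (R : realType) (m n : nat) (M : 'M[R]_(m, n)) :
  'M[R[i]]_(m, n) := map_mx (real_complex R) M.

(* [eigenvalue] is the library's row-vector notion; the spectrum is the same
   as for column vectors. *)
Definition hurwitz (R : realType) (n : nat) (M : 'M[R]_n) : Prop :=
  forall l : R[i], eigenvalue (complexify M) l -> complex.Re l < 0.

Definition stabilizable (R : realType) (n m : nat)
    (A : 'M[R]_n) (B : 'M[R]_(n, m)) : Prop :=
  exists F : 'M[R]_(m, n), hurwitz (A - B *m F).

Definition detectable (R : realType) (n q : nat)
    (A : 'M[R]_n) (C : 'M[R]_(q, n)) : Prop :=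
  stabilizable A^T C^T.

(* [0 <=] on [R[i]] is the partial order: real and nonnegative. *)
Definition hermitian_psd (R : realType) (n : nat) (P : 'M[R[i]]_n) : Prop :=
  P \is hermsymmx /\ forall v : 'cV[R[i]]_n, 0 <= (v ^t* *m P *m v) 0 0.

(* [Sigma] is an arbitrary real weighted adjacency matrix without self-loops. *)
Definition is_graph (R : realType) (N : nat) (Sigma : 'M[R]_N) : Prop :=
  forall i, Sigma i i = 0.

Definition coupling_input (R : realType) (n m q N : nat) (C : 'M[R]_(q, n))
    (K : 'M[R]_(m, q)) (Sigma : 'M[R]_N) (x : 'I_N -> 'cV[R]_n) (i : 'I_N) :
  'cV[R]_m :=
  K *m \sum_j Sigma i j *: (C *m x j - C *m x i).

(* Solutions live on [0, +oo[: the values of [x i] at negative times are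
   irrelevant, and at time 0 only one-sided continuity is required. *)
Definition network_trajectory (R : realType) (n m q N : nat)
    (A : 'M[R]_n) (B : 'M[R]_(n, m)) (C : 'M[R]_(q, n))
    (K : 'M[R]_(m, q)) (Sigma : 'M[R]_N) (x : 'I_N -> R -> 'cV[R]_n) : Prop :=
  forall i, {within `[0, +oo[, continuous (x i)} /\
    forall t : R, 0 < t ->
      is_derive t 1 (x i)
        (A *m x i t + B *m coupling_input C K Sigma (fun j => x j t) i).

(* Each initial condition determines exactly one trajectory, so quantifying over
   trajectories is quantifying over initial conditions. *)
Definition synchronizes (R : realType) (n m q N : nat)
    (A : 'M[R]_n) (B : 'M[R]_(n, m)) (C : 'M[R]_(q, n))
    (K : 'M[R]_(m, q)) (Sigma : 'M[R]_N) : Prop :=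
  forall x, network_trajectory A B C K Sigma x ->
  forall i j, x i t - x j t @[t --> +oo] --> (0 : 'cV[R]_n).

Definition output_feedback_synchronizable (R : realType) (n m q N : nat)
    (A : 'M[R]_n) (B : 'M[R]_(n, m)) (C : 'M[R]_(q, n)) : Prop :=
  exists (K : 'M[R]_(m, q)) (Sigma : 'M[R]_N),
    is_graph Sigma /\ synchronizes A B C K Sigma.
Arguments output_feedback_synchronizable {R n m q} N A B C.

(* Main.v *)
From HB Require Import structures.
Require Import Defs.
From mathcomp Require Import all_boot all_order all_algebra.
From mathcomp Require Import all_classical all_reals all_analysis.
From mathcomp Require Import complex.
From mathcomp Require Import ring lra zify.
Import Order.TTheory GRing.Theory Num.Theory.
Import numFieldNormedType.Exports.

Set Implicit Arguments.
Unset Strict Implicit.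
Unset Printing Implicit Defensive.

(** Write H = B K C and let W be the opposite of the graph Laplacian, so that
    the rows of W sum to 0 and the stacked state X (one column per node) obeys
    X' = A X + H X W^T.  If om is a column with W^T om = l om, the complex
    combination z = X om of the nodes is autonomous: z' = (A + l H) z.  The
    modes with sum om = 0 are exactly the disagreements between nodes, so
    synchronization is a matter of stability of the matrices A + l H.  The
    theorem goes through the single intermediate condition

      (S)  A - s B K C is Hurwitz for some real K and some complex s.

    Synchronizability implies (S) ([synchronizes_hurwitz_mode]): the row sums of
    W vanish, hence some disagreement mode om exists ([disagreement_mode]); if a
    left eigenvector eta of A + l H had an eigenvalue with nonnegative real
    part, then |eta z|^2 would be nondecreasing along a trajectory chosen to
    start away from 0, whereas synchronization forces it to tend to 0.

    (S) implies synchronizability when N is odd ([hurwitz_synchronizable]): the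
    nonzero nodes can be grouped in pairs, all following node 0, and the weights
    inside a pair can be chosen so that the two deviations from node 0 are the
    real and imaginary parts of one complex mode with the multiplier l = -s.
    This is where parity enters: a nonreal l needs two real coordinates.

    (S) implies (i), (ii) and (iii).  For (iii), solve the Lyapunov equation of
    the Hurwitz matrix ([lyapunov_hurwitz]).  For (i), the condition that
    M = A - B G be Hurwitz for a complex G amounts to M X + X adj(M) < 0 for
    some X > 0, which is linear in X and Y = G X; taking X + conj X and
    Y + conj Y gives a real solution, hence a real feedback
    ([real_stabilizing_feedback]).  For (ii), apply the same to the transposes.

    (ii) and (iii) imply (S) ([lyapunov_detectable_hurwitz]): evaluating the
    equation at an eigenvector v of Acl whose eigenvalue has nonnegative real
    part shows that C v = 0, so v is an unobservable unstable mode of A.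

    All statements on Hurwitz matrices rest on one normal form
    ([hurwitzC_dissipative]): a Hurwitz matrix is similar to some T with
    T + adj(T) negative definite.  It provides decay of the modes through
    |z|^2, as well as unique solvability and positivity for the Lyapunov
    equation. *)

Local Open Scope classical_set_scope.
Local Open Scope ring_scope.
Local Open Scope sesquilinear_scope.

(** * Hermitian forms and the Lyapunov equation *)

Section Lyapunov.
Variable C : numClosedFieldType.

Lemma adjmxM m n p (M : 'M[C]_(m, n)) (N : 'M[C]_(n, p)) :
  (M *m N)^t* = N^t* *m M^t*.
Proof. by rewrite trmx_mul map_mxM. Qed.

Lemma adjmxD m n (M N : 'M[C]_(m, n)) : (M + N)^t* = M^t* + N^t*.
Proof. by rewrite linearD map_mxD. Qed.

Lemma adjmxN m n (M : 'M[C]_(m, n)) : (- M)^t* = - M^t*.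
Proof. by rewrite linearN map_mxN. Qed.

Lemma adjmxZ m n a (M : 'M[C]_(m, n)) : (a *: M)^t* = a^* *: M^t*.
Proof. by rewrite linearZ map_mxZ. Qed.

Lemma adjmxE m n (M : 'M[C]_(m, n)) i j : (M^t* ) i j = (M j i)^*.
Proof. by rewrite mxE [in LHS]mxE. Qed.

Lemma hermsymmxP n (M : 'M[C]_n) : reflect (M^t* = M) (M \is hermsymmx).
Proof.
apply: (iffP idP) => [/is_hermitianmxP|] MM.
  by rewrite [RHS]MM expr0 scale1r.
by apply/is_hermitianmxP; rewrite expr0 scale1r MM.
Qed.

Definition hform n (S : 'M[C]_n) (v : 'cV[C]_n) : C := (v^t* *m S *m v) 0 0.

Definition posdef n (S : 'M[C]_n) := forall v, v != 0 -> 0 < hform S v.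

Lemma hformD n (S T : 'M[C]_n) v : hform (S + T) v = hform S v + hform T v.
Proof. by rewrite /hform mulmxDr mulmxDl mxE. Qed.

Lemma hformN n (S : 'M[C]_n) v : hform (- S) v = - hform S v.
Proof. by rewrite /hform mulmxN mulNmx mxE. Qed.

Lemma hform_congr m n (S : 'M[C]_n) (R : 'M[C]_(n, m)) v :
  hform (R^t* *m S *m R) v = hform S (R *m v).
Proof. by rewrite /hform adjmxM !mulmxA. Qed.

Lemma hform_adj n (S : 'M[C]_n) v : hform (S^t* ) v = (hform S v)^*.
Proof.
have -> : hform (S^t* ) v = ((v^t* *m S *m v)^t*) 0 0.
  by rewrite !adjmxM trmxCK mulmxA.
by rewrite mxE [in LHS]mxE.
Qed.

Lemma hform_conj n (S : 'M[C]_n) v :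
  hform (map_mx Num.conj S) v = (hform S (map_mx Num.conj v))^*.
Proof.
have -> : (hform S (map_mx Num.conj v))^* =
    (map_mx Num.conj ((map_mx Num.conj v)^t* *m S *m map_mx Num.conj v)) 0 0.
  by rewrite mxE.
rewrite !map_mxM/=.
have -> : map_mx Num.conj (map_mx Num.conj v) = v.
  by apply/matrixP => i j; rewrite !mxE conjCK.
congr ((_ *m _ *m _) 0 0).
by apply/matrixP => i j; rewrite !mxE conjCK.
Qed.

Lemma conjmx_eq0 m n (M : 'M[C]_(m, n)) : (map_mx Num.conj M == 0) = (M == 0).
Proof. exact: map_mx_eq0. Qed.

Lemma adjmx_eq0 m n (M : 'M[C]_(m, n)) : (M^t* == 0) = (M == 0).
Proof. by rewrite map_mx_eq0 trmx_eq0. Qed.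

Lemma hform1E n (v : 'cV[C]_n) : hform 1%:M v = \sum_i `|v i 0| ^+ 2.
Proof.
rewrite /hform mulmx1 mxE; apply: eq_bigr => i _.
by rewrite !mxE mulrC -normCK.
Qed.

Lemma posdef1 n : posdef (1%:M : 'M[C]_n).
Proof.
move=> v v0; rewrite hform1E lt_def sumr_ge0 ?andbT => [|i _]; last first.
  exact: exprn_ge0.
apply: contra v0 => /eqP s0; apply/eqP/colP => i; rewrite mxE.
have /eqP : `|v i 0| ^+ 2 = 0.
  by apply: (psumr_eq0P _ s0) => // j _; exact: exprn_ge0.
by rewrite sqrf_eq0 normr_eq0 => /eqP.
Qed.

Lemma hform1_ge0 n (v : 'cV[C]_n) : 0 <= hform 1%:M v.
Proof. by rewrite hform1E sumr_ge0 // => i _; exact: exprn_ge0. Qed.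

(** The basic Lyapunov computation: along an eigenvector, the Lyapunov
    expression is twice the real part of the eigenvalue times the form. *)
Lemma hform_eigen n (N X : 'M[C]_n) (v : 'cV[C]_n) l :
  N^t* *m v = l *: v -> hform (N *m X + X *m N^t*) v = (l + l^*) * hform X v.
Proof.
move=> Nv; have vN : v^t* *m N = l^* *: v^t*.
  by rewrite -adjmxZ -Nv adjmxM trmxCK.
rewrite hformD /hform !mulmxA vN -(mulmxA _ (N^t* )) Nv.
by rewrite -!scalemxAl -scalemxAr !mxE mulrDl addrC.
Qed.

(** The real part of [l] is tested through [l + l^*], which is twice that real
    part, so that the notion makes sense in any algebraically closed field with
    conjugation. *)
Definition hurwitzC n (M : 'M[C]_n) :=
  forall l, eigenvalue M l -> l + l^* < 0.

(** Each off-diagonal product is at most half the sum of two squares, so the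
    off-diagonal part costs at most [k *+ n] times the squared norm, which half
    of the diagonal part can absorb. *)
Lemma diag_dominant_hform n (S : 'M[C]_n) (d k : C) :
  S^t* = S -> 0 <= k -> (forall i, S i i <= - d *+ 2) ->
  (forall i j, i != j -> `|S i j| <= k) -> k *+ n <= d ->
  forall v, hform S v <= - d * hform 1%:M v.
Proof.
move=> Sh k0 Sii Sij kn v.
have kdP : 0 <= d by apply: le_trans kn; rewrite mulrn_wge0.
set q := hform 1%:M v.
have q0 : 0 <= q := hform1_ge0 v.
pose D := \sum_i S i i * `|v i 0| ^+ 2.
pose E := \sum_i \sum_(j | j != i) (v i 0)^* * S i j * v j 0.
have SE : hform S v = D + E.
  rewrite /hform mxE -big_split/=.
  under eq_bigr => j _ do rewrite !mxE mulr_suml.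
  rewrite exchange_big/=; apply: eq_bigr => i _.
  rewrite (bigD1 i)//= !mxE; congr (_ + _).
  by rewrite normCK; ring.
have DE : D <= (- d *+ 2) * q.
  rewrite /q hform1E mulr_sumr; apply: ler_sum => i _.
  by rewrite ler_wpM2r// exprn_ge0.
have Dreal : D \is Num.real.
  by rewrite (ler_real DE) realM ?(ger0_real q0)// rpredMn// realN ger0_real.
have Sreal : hform S v \is Num.real.
  by apply/CrealP; rewrite -hform_adj Sh.
have Ereal : E \is Num.real.
  by rewrite -(addrK D E) (addrC E) -SE realB.
have EE : E <= k *+ n * q.
  apply: (le_trans (real_ler_norm Ereal)).
  apply: (le_trans (ler_norm_sum _ _ _)).
  pose a i : C := `|v i 0|.
  have step i : `|\sum_(j | j != i) (v i 0)^* * S i j * v j 0| <=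
       \sum_j k * ((a i ^+ 2 + a j ^+ 2) / 2).
    apply: (le_trans (ler_norm_sum _ _ _)).
    rewrite [leRHS](bigID (fun j => j != i))/=.
    rewrite -[leLHS]addr0; apply: lerD; last first.
      apply: sumr_ge0 => j _.
      by rewrite mulr_ge0// divr_ge0// addr_ge0// exprn_ge0// normr_ge0.
    apply: ler_sum => j ji; rewrite !normrM norm_conjC -/(a i) -/(a j).
    rewrite mulrAC mulrC ler_pM ?mulr_ge0 ?normr_ge0 ?Sij 1?eq_sym//.
    rewrite ler_pdivlMr// -subr_ge0.
    rewrite (_ : _ - _ = (a i - a j) ^+ 2); last by rewrite sqrrB; ring.
    by rewrite -realEsqr realB// normr_real.
  apply: (le_trans (ler_sum _ (fun i _ => step i))).
  rewrite (_ : \sum_i _ = k *+ n * q)//.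
  rewrite /q hform1E.
  under eq_bigr => i _ do
    rewrite -mulr_sumr -mulr_suml big_split/= sumr_const card_ord.
  rewrite -mulr_sumr -mulr_suml big_split/= sumr_const card_ord -sumrMnl.
  set s := \sum_i _ ; rewrite /a -/s.
  have -> : s = (\sum_i `|v i 0| ^+ 2) *+ n by rewrite /s sumrMnl.
  rewrite -mulr2n -[X in X / 2]mulr_natr mulfK ?pnatr_eq0//.
  by rewrite mulrnAr mulrnAl.
rewrite SE (le_trans (lerD DE EE))//.
rewrite -mulrDl ler_wpM2r// mulr2n -addrA gerDl.
by rewrite addrC subr_le0.
Qed.

Lemma pos_lower_bound n (f : 'I_n -> C) :
  (forall i, 0 < f i) -> exists2 d, 0 < d & forall i, d <= f i.
Proof.
move=> f0; have s0 : 0 <= \sum_i (f i)^-1.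
  by apply: sumr_ge0 => i _; rewrite invr_ge0 ltW.
(* The harmonic sum bounds all f i from below at once; minima would need a
   total order. *)
exists (1 + \sum_i (f i)^-1)^-1 => [|i]; first by rewrite invr_gt0 ltr_wpDr.
rewrite -[leRHS]invrK lef_pV2 ?posrE ?invr_gt0 ?ltr_wpDr//.
rewrite (bigD1 i)//= addrCA lerDl addr_ge0// sumr_ge0// => j _.
by rewrite invr_ge0 ltW.
Qed.

Definition dissipative n (d : C) (T : 'M[C]_n) :=
  forall v, hform (T + T^t* ) v <= - d * hform 1%:M v.

(** By Schur triangularization: the diagonal entries are the eigenvalues. *)
Lemma hurwitzC_trig n (M : 'M[C]_n) : hurwitzC M ->
  exists2 U, U \in unitmx &
    is_trig_mx (U *m M *m invmx U) /\
    forall i, (U *m M *m invmx U) i i + ((U *m M *m invmx U) i i)^* < 0.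
Proof.
case: n M => [|n] M hM.
  by exists 1%:M; rewrite ?unitmx1//; split=> [|[]//]; apply/is_trig_mxP => -[].
have [U Uu Ut] := Schur M (ltn0Sn n); have Uun := unitarymx_unit Uu.
rewrite /similar_to/= conjumx// in Ut.
exists U => //; split=> // i; apply: hM.
apply: (@eigenvalue_conjmx _ _ _ U); first by rewrite stablemx_unit.
  by rewrite row_free_unit.
rewrite conjumx//= [_ \in _]eigenvalue_root_char char_poly_trig//.
rewrite -(big_map (fun i => (U *m M *m invmx U) i i) predT (fun a => 'X - a%:P)).
by rewrite root_prod_XsubC; apply/mapP; exists i => //; exact: mem_index_enum.
Qed.

(** After triangularization, conjugating by the diagonal matrix of the powers of
    a small [e] multiplies the entry below the diagonal at (i, j) by e ^ (i - j),
    so the off-diagonal part becomes negligible next to the eigenvalues. *)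
Lemma hurwitzC_dissipative n (M : 'M[C]_n) : hurwitzC M ->
  exists R, exists2 d, 0 < d &
    R \in unitmx /\ dissipative d (R *m M *m invmx R).
Proof.
move=> /hurwitzC_trig[U Uu []]; set L := U *m M *m invmx U => Ltrig Ldiag.
have [d0 d00 Ld0] : exists2 d, 0 < d & forall i, d <= - (L i i + (L i i)^* ).
  by apply: pos_lower_bound => i; rewrite oppr_gt0.
pose d := d0 / 2; have d_gt0 : 0 < d by rewrite divr_gt0.
pose c := \sum_i \sum_j `|L i j|.
have Lc i j : `|L i j| <= c.
  rewrite /c (bigD1 i)//= (bigD1 j)//= -addrA lerDl addr_ge0// sumr_ge0// => k _.
  by apply: sumr_ge0.
have c0 : 0 <= c by apply: sumr_ge0 => i _; apply: sumr_ge0.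
have cn0 : 0 <= c *+ n by rewrite mulrn_wge0.
(* This [e] satisfies both e <= 1 and e * c * n <= d. *)
pose e : C := d / (d + c *+ n).
have e_gt0 : 0 < e by rewrite divr_gt0// ltr_wpDr.
have e_le1 : e <= 1 by rewrite ler_pdivrMr ?ltr_wpDr// mul1r lerDl.
pose D : 'M[C]_n := diag_mx (\row_i e ^+ i).
pose D' : 'M[C]_n := diag_mx (\row_i (e ^+ i)^-1).
have DD' : D *m D' = 1%:M.
  apply/matrixP => i j; rewrite mul_diag_mx !mxE; case: eqVneq => [->|_].
    by rewrite !mulr1n mulfV// expf_neq0// gt_eqF.
  by rewrite !mulr0n mulr0.
have [Du _] := mulmx1_unit DD'.
have ivD : invmx D = D' by rewrite -[LHS]mulmx1 -DD' mulKmx.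
have ivU : invmx (D *m U) = invmx U *m D'.
  have DUu : D *m U \in unitmx by rewrite unitmx_mul Du.
  apply: (can_inj (mulKmx DUu)); rewrite mulmxV//.
  by rewrite mulmxA mulmxK// DD'.
exists (D *m U), d => //; split; first by rewrite unitmx_mul Du.
set T := _ *m invmx (D *m U).
have TE i j : T i j = e ^+ i * L i j * (e ^+ j)^-1.
  rewrite /T ivU !mulmxA -(mulmxA D) -(mulmxA D) -/L.
  by rewrite mul_mx_diag mxE mul_diag_mx !mxE.
have e0 k : e ^+ k != 0 by rewrite expf_neq0// gt_eqF.
have Tle (i j : 'I_n) : (j < i)%N -> `|T i j| <= e * c.
  move=> ji; rewrite TE mulrAC normrM ler_pM//.
  rewrite -(subnKC ji) addSnnS exprD mulrAC mulfV// mul1r.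
  rewrite ger0_norm ?exprn_ge0 ?(ltW e_gt0)// exprS -[leRHS]mulr1.
  by rewrite ler_pM2l// exprn_ile1// ltW.
have T0 (i j : 'I_n) : (i < j)%N -> T i j = 0.
  by move=> ij; rewrite TE (is_trig_mxP Ltrig)// mulr0 mul0r.
have ec0 : 0 <= e * c by rewrite mulr_ge0// ltW.
apply: (@diag_dominant_hform _ _ _ (e * c)) => //.
- by rewrite adjmxD trmxCK addrC.
- move=> i; rewrite mxE adjmxE TE mulrAC mulfV// mul1r.
  by rewrite mulNrn -(mulr_natr d) divfK ?pnatr_eq0// lerNr.
- move=> i j; rewrite neq_ltn mxE adjmxE => /orP[] ij.
    by rewrite T0// add0r norm_conjC Tle.
  by rewrite [T j i]T0// conjC0 addr0 Tle.
- rewrite -mulrnAr /e mulrAC ler_pdivrMr ?ltr_wpDr//.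
  by rewrite ler_pM2l// lerDr ltW.
Qed.

Definition possemidef n (S : 'M[C]_n) := forall v, 0 <= hform S v.

Lemma trace_hform n p (S : 'M[C]_n) (X : 'M[C]_(n, p)) :
  \tr (X^t* *m S *m X) = \sum_j hform S (col j X).
Proof.
apply: eq_bigr => j _; rewrite /hform !mxE; apply: eq_bigr => i _.
rewrite !mxE; congr (_ * _); apply: eq_bigr => k _.
by rewrite !mxE.
Qed.

Lemma col_neq0 n p (X : 'M[C]_(n, p)) : X != 0 -> exists j, col j X != 0.
Proof.
move=> X0; apply/existsP; apply: contraR X0; rewrite negb_exists => /forallP X0.
apply/eqP/matrixP => i j; have := X0 j; rewrite negbK => /eqP/colP/(_ i).
by rewrite !mxE.
Qed.

Lemma posdef_trace_gt0 n p (S : 'M[C]_n) (X : 'M[C]_(n, p)) :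
  posdef S -> X != 0 -> 0 < \tr (X^t* *m S *m X).
Proof.
move=> Sp /col_neq0[j Xj]; rewrite trace_hform (bigD1 j)//=.
rewrite ltr_wpDr ?Sp// sumr_ge0// => k _.
have [->|/Sp/ltW//] := eqVneq (col k X) 0.
by rewrite /hform mulmx0 mxE.
Qed.

Lemma dissipative_posdef n d (T : 'M[C]_n) :
  0 < d -> dissipative d T -> posdef (- (T + T^t* )).
Proof.
move=> d0 Td v v0; rewrite hformN oppr_gt0 (le_lt_trans (Td v))//.
by rewrite mulNr oppr_lt0 mulr_gt0// posdef1.
Qed.

Definition lyapunov n (T X : 'M[C]_n) := T^t* *m X + X *m T.

Lemma lyapunov_is_linear n (T : 'M[C]_n) : linear (lyapunov T).
Proof.
move=> a X Y; rewrite /lyapunov mulmxDr mulmxDl -scalemxAr -scalemxAl scalerDr.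
by rewrite addrACA.
Qed.

HB.instance Definition _ n (T : 'M[C]_n) :=
  GRing.isLinear.Build C _ _ _ (lyapunov T) (@lyapunov_is_linear n T).

(** With S = T + adj(T), the traces of adj(X) S X and of X S adj(X) add up to
    twice the real part of the trace of adj(X) times the Lyapunov expression; both
    are negative if X is nonzero and S negative definite. *)
Lemma lyapunov_inj n (T X : 'M[C]_n) :
  posdef (- (T + T^t* )) -> lyapunov T X = 0 -> X = 0.
Proof.
move=> Tp TX0; apply: contraTeq isT => X0.
have := addr_gt0 (posdef_trace_gt0 Tp X0)
  (posdef_trace_gt0 Tp (_ : X^t* != 0)).
rewrite adjmx_eq0 => /(_ X0).
suff -> : \tr (X^t* *m - (T + T^t* ) *m X) +
          \tr ((X^t* )^t* *m - (T + T^t* ) *m X^t* ) =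
          - (\tr (X^t* *m lyapunov T X) + \tr ((lyapunov T X)^t* *m X)).
  by rewrite TX0 mulmx0 trmx0 map_mx0 mul0mx linear0 addr0 oppr0 ltxx.
rewrite /lyapunov adjmxD !adjmxM !trmxCK !(mulmxN, mulNmx) !linearN/= -opprD.
congr (- _); rewrite !(mulmxDr, mulmxDl) !linearD/= !mulmxA.
rewrite (mxtrace_mulC (X *m T)) (mxtrace_mulC (T^t* *m X^t* )) !mulmxA.
ring.
Qed.

(** An injective linear endomorphism of a finite-dimensional space is onto. *)
Lemma lyapunov_surj n (T Q : 'M[C]_n) :
  posdef (- (T + T^t* )) -> exists P, lyapunov T P = Q.
Proof.
move=> Tp; have Tu : lin_mx (lyapunov T) \in unitmx.
  rewrite -row_free_unit -kermx_eq0; apply/eqP/row_matrixP => i.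
  rewrite row0 -[LHS]vec_mxK; apply/eqP; rewrite mxvec_eq0; apply/eqP.
  apply: (lyapunov_inj Tp); apply/eqP; rewrite -mxvec_eq0 -mul_vec_lin vec_mxK.
  by apply/eqP/sub_kermxP; exact: row_sub.
exists (vec_mx (mxvec Q *m invmx (lin_mx (lyapunov T)))).
apply: (can_inj mxvecK).
by rewrite -mul_vec_lin vec_mxK mulmxKV.
Qed.

Lemma lyapunov_adj n (T X : 'M[C]_n) : (lyapunov T X)^t* = lyapunov T (X^t* ).
Proof. by rewrite /lyapunov adjmxD !adjmxM trmxCK addrC. Qed.

(** Spectral theorem: the form is a combination of squares whose coefficients
    are the eigenvalues. *)
Lemma hermsym_possemidef n (P : 'M[C]_n) : P^t* = P ->
  (forall (v : 'cV[C]_n) l, v != 0 -> P *m v = l *: v -> 0 <= l) -> possemidef P.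
Proof.
move=> Ph Peig w.
have /hermitian_normalmx/orthomx_spectralP := introT (hermsymmxP P) Ph.
set U := spectralmx P; set d := spectral_diag P => PE.
have Uu : U \is unitarymx := spectral_unitarymx P.
have Uun := unitarymx_unit Uu.
rewrite invmx_unitary// in PE.
have d0 i : 0 <= d 0 i.
  apply: (Peig (U^t* *m delta_mx i 0)).
    rewrite -(inj_eq (can_inj (mulKmx Uun))) mulmx0 mulmxA.
    rewrite (unitarymxP Uu) mul1mx.
    apply/eqP => /matrixP/(_ i 0); rewrite !mxE !eqxx/= => /eqP.
    by rewrite oner_eq0.
  rewrite PE !mulmxA mulmxtVK// -!mulmxA scalemxAr; congr (_ *m _).
  apply/matrixP => j k; rewrite mul_diag_mx !mxE.
  by case: eqVneq => [->//|_]; rewrite !mulr0.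
rewrite PE hform_congr /hform mxE sumr_ge0// => i _.
rewrite mul_mx_diag mxE adjmxE mulrAC mulr_ge0//.
by rewrite mulrC -normCK exprn_ge0.
Qed.

(** Uniqueness makes the solution Hermitian.  At an eigenvector v of P with
    eigenvalue l, the equation reads l * hform (T + adj(T)) v = - hform Q v,
    which forces l >= 0. *)
Lemma lyapunov_dissipative n (T Q : 'M[C]_n) :
  posdef (- (T + T^t* )) -> Q^t* = Q -> possemidef Q ->
  exists P, [/\ P^t* = P, possemidef P & lyapunov T P = - Q].
Proof.
move=> Tp Qh Qp; have [P PE] := lyapunov_surj (- Q) Tp.
have Ph : P^t* = P.
  apply/eqP; rewrite -subr_eq0; apply/eqP; apply: (lyapunov_inj Tp).
  by rewrite linearB/= -lyapunov_adj PE adjmxN Qh subrr.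
exists P; split=> //; apply: hermsym_possemidef => // v l v0 Pv.
have Pvl : v^t* *m P = l^* *: v^t* by rewrite -adjmxZ -Pv adjmxM Ph.
have lr : l^* = l.
  apply: (@mulIf _ (hform 1%:M v)); first by rewrite gt_eqF ?posdef1.
  have : v^t* *m P *m v = v^t* *m (P *m v) by rewrite mulmxA.
  rewrite Pvl Pv -scalemxAl -scalemxAr => /matrixP/(_ 0 0); rewrite mxE [RHS]mxE.
  by rewrite /hform mulmx1.
have : hform (lyapunov T P) v = l * hform (T + T^t* ) v.
  rewrite /lyapunov !hformD /hform !mulmxA Pvl lr -(mulmxA _ P) Pv.
  by rewrite -!scalemxAl -scalemxAr mxE [X in _ + X]mxE -mulrDr addrC.
have := Tp v v0; have := Qp v.
rewrite PE !hformN oppr_gt0 => Qv Tv /eqP; rewrite eqr_oppLR => /eqP E.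
by rewrite -oppr_le0 -(nmulr_rge0 _ Tv) mulrN mulrC -E.
Qed.

(** The equation is transported by congruence along the change of basis that
    makes M dissipative. *)
Lemma lyapunov_hurwitz n (M Q : 'M[C]_n) :
  hurwitzC M -> Q^t* = Q -> possemidef Q ->
  exists P, [/\ P^t* = P, possemidef P & lyapunov M P = - Q].
Proof.
move=> /hurwitzC_dissipative[R [d d0 [Ru /(dissipative_posdef d0) Tp]]] Qh Qp.
pose Q' := (invmx R)^t* *m Q *m invmx R.
have iRR : (R^t* ) *m (invmx R)^t* = 1%:M.
  by rewrite -adjmxM mulVmx// trmx1 map_mx1.
have [||P [Ph Pp PE]] := lyapunov_dissipative (Q := Q') Tp.
- by rewrite /Q' !adjmxM Qh trmxCK mulmxA.
- by move=> v; rewrite hform_congr Qp.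
exists (R^t* *m P *m R); split.
- by rewrite !adjmxM Ph trmxCK mulmxA.
- by move=> v; rewrite hform_congr Pp.
have : R^t* *m lyapunov (R *m M *m invmx R) P *m R = - (R^t* *m Q' *m R).
  by rewrite PE mulmxN mulNmx.
rewrite /Q' !mulmxA iRR mul1mx mulmxKV// => <-.
rewrite /lyapunov mulmxDr mulmxDl !adjmxM !mulmxA iRR mul1mx.
by rewrite mulmxKV.
Qed.

(** The converse direction of Lyapunov's theorem, in its dual form
    N X + X adj(N). *)
Lemma lyapunov_hurwitzC n (N X : 'M[C]_n) : posdef X ->
  posdef (- (N *m X + X *m N^t* )) -> hurwitzC N.
Proof.
move=> Xp Np l /eigenvalueP[u ul u0].
have v0 : u^t* != 0 by rewrite adjmx_eq0.
have Nv : N^t* *m u^t* = l^* *: u^t* by rewrite -adjmxM ul adjmxZ.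
have := Np _ v0; rewrite hformN oppr_gt0 (hform_eigen X Nv) conjCK addrC.
by rewrite pmulr_llt0 // Xp.
Qed.

Lemma posdef_unit n (S : 'M[C]_n) : posdef S -> S \in unitmx.
Proof.
move=> Sp; rewrite -unitmx_tr -row_free_unit -kermx_eq0; apply/eqP/row_matrixP => i.
rewrite row0; apply: (can_inj (@trmxK _ _ _)); rewrite trmx0.
set v := _^T; apply: contraTeq isT => /Sp.
rewrite /hform -mulmxA (_ : S *m v = 0) ?mulmx0 ?mxE ?ltxx//.
by rewrite -[S]trmxK -trmx_mul (sub_kermxP _) ?trmx0 ?row_sub.
Qed.

(** The dual Lyapunov inequality for A - B G is linear in the pair (X, G X), and
    A and B are real; its solutions are therefore stable under conjugation and
    addition, and the pair obtained by adding the conjugate is real. *)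
Lemma real_stabilizing_feedback n m (A : 'M[C]_n) (B : 'M[C]_(n, m))
    (G : 'M[C]_(m, n)) :
  map_mx Num.conj A = A -> map_mx Num.conj B = B -> hurwitzC (A - B *m G) ->
  exists2 F : 'M[C]_(m, n), map_mx Num.conj F = F & hurwitzC (A - B *m F).
Proof.
set M := A - B *m G => Ar Br.
move=> /hurwitzC_dissipative[R [d d0 [Ru /(dissipative_posdef d0) Tp]]].
set J := (invmx R)^t*.
have RJ : R^t* *m J = 1%:M by rewrite -adjmxM mulVmx// trmx1 map_mx1.
have Ju : J \in unitmx by rewrite map_unitmx unitmx_tr unitmx_inv.
(* X is the inverse of the Gram matrix of R: it turns dissipativity of
   R M R^-1 into the dual Lyapunov inequality for M. *)
pose X := invmx R *m J.
have J0 (v : 'cV[C]_n) : v != 0 -> J *m v != 0.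
  by apply: contra_neq => Jv0; rewrite -[v](mulKmx Ju) Jv0 mulmx0.
have Xp : posdef X.
  move=> v v0; rewrite /X -[invmx R]trmxCK -[X in X *m _]mulmx1 hform_congr.
  by rewrite posdef1// J0.
have Sp : posdef (- (M *m X + X *m M^t* )).
  move=> v v0; have := Tp _ (J0 _ v0); rewrite -hform_congr trmxCK.
  congr (0 < hform _ v); rewrite mulmxN mulNmx; congr (- _).
  rewrite mulmxDr mulmxDl !adjmxM !mulmxA mulVmx// mul1mx -/J.
  by rewrite -(mulmxA _ (R^t* )) RJ mulmx1.
pose cj p q : 'M[C]_(p, q) -> 'M[C]_(p, q) := map_mx (@Num.conj C).
have cjK p q : involutive (cj p q).
  by move=> Z; apply/matrixP => i j; rewrite !mxE conjCK.
have cj_adj p q (Z : 'M[C]_(p, q)) : cj _ _ (Z^t* ) = (cj _ _ Z)^t*.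
  by apply/matrixP => i j; rewrite !mxE.
have cjp (S : 'M[C]_n) : posdef S -> posdef (S + cj _ _ S).
  move=> Spos v v0; rewrite hformD hform_conj.
  have S0 : 0 < hform S (map_mx Num.conj v).
    by apply: Spos; rewrite conjmx_eq0.
  by rewrite (conj_Creal (gtr0_real S0)); apply: addr_gt0 => //; exact: Spos.
pose Y := G *m X; pose Xc := X + cj _ _ X; pose Yc := Y + cj _ _ Y.
have Xcu : Xc \in unitmx by apply/posdef_unit/cjp.
have cjXc : cj _ _ Xc = Xc by rewrite /cj map_mxD -!/(cj _ _ _) cjK addrC.
have cjYc : cj _ _ Yc = Yc by rewrite /cj map_mxD -!/(cj _ _ _) cjK addrC.
exists (Yc *m invmx Xc).
  by rewrite map_mxM/= map_invmx -!/(cj _ _ _) cjXc cjYc.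
apply: (lyapunov_hurwitzC (X := Xc)); first exact: cjp.
have NX : (A - B *m (Yc *m invmx Xc)) *m Xc = M *m X + cj _ _ (M *m X).
  rewrite mulmxBl -!mulmxA mulVmx// mulmx1 /cj map_mxM/= map_mxB map_mxM/= Ar Br.
  rewrite -!/(cj _ _ _) /M !mulmxBl /Yc /Xc !mulmxDr opprD addrACA /Y.
  by rewrite -!mulmxA; congr (_ + (_ - _ *m _)); rewrite /cj map_mxM.
have Xh : X^t* = X by rewrite /X adjmxM /J trmxCK.
have Xch : Xc^t* = Xc by rewrite /Xc adjmxD -cj_adj Xh.
rewrite -[X in X *m _^t* ]Xch -adjmxM NX adjmxD -cj_adj.
rewrite adjmxM Xh addrACA /cj -map_mxD -/(cj _ _ _).
have -> Z : - (Z + cj n n Z) = - Z + cj _ _ (- Z) by rewrite /cj map_mxN opprD.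
exact: cjp.
Qed.

End Lyapunov.

(** * Linear differential equations over the reals *)

Section LinearOde.
Variable R : realType.

Lemma is_derive_mxP p r (X : R -> 'M[R]_(p, r)) (t : R) (D : 'M[R]_(p, r)) :
  is_derive t 1 X D <->
  forall i j, is_derive t 1 (fun u => X u i j) (D i j).
Proof.
split=> [[dX XD] i j|XD].
  apply: DeriveDef; first exact: (derivable_mxP X t 1).1.
  by rewrite -XD derive_mx// mxE.
have dX : derivable X t 1.
  by apply/derivable_mxP => i j; have [] := XD i j.
apply: DeriveDef => //; rewrite derive_mx//; apply/matrixP => i j.
by rewrite mxE; have [_ ->] := XD i j.
Qed.

Section LinearFlow.
Variables (p r : nat) (f : {linear 'M[R]_(p, r) -> 'M[R]_(p, r)}).
Implicit Types X Y : 'M[R]_(p, r).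

Let fE Y i j :
  f Y i j = \sum_k \sum_l Y k l * f (delta_mx k l) i j.
Proof.
rewrite {1}(matrix_sum_delta Y) linear_sum summxE; apply: eq_bigr => k _.
by rewrite linear_sum summxE; apply: eq_bigr => l _; rewrite linearZ mxE.
Qed.

(* The entrywise sum norm; [c] below bounds the operator norm of [f] for it. *)
Let l1 Y := \sum_i \sum_j `|Y i j|.

Let l1_ge Y i j : `|Y i j| <= l1 Y.
Proof.
rewrite /l1 (bigD1 i)//= (bigD1 j)//= -addrA lerDl addr_ge0// sumr_ge0// => k _.
by apply: sumr_ge0.
Qed.

Let c := \sum_k \sum_l l1 (f (delta_mx k l)).

Let l1_le Y : l1 (f Y) <= c * l1 Y.
Proof.
have l1_ge0 Z : 0 <= l1 Z by apply: sumr_ge0 => i _; apply: sumr_ge0.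
rewrite /l1; under eq_bigr do under eq_bigr do rewrite fE.
apply: (@le_trans _ _ (\sum_i \sum_j \sum_k \sum_l
   `|f (delta_mx k l) i j| * l1 Y)).
  apply: ler_sum => i _; apply: ler_sum => j _.
  apply: (le_trans (ler_norm_sum _ _ _)); apply: ler_sum => k _.
  apply: (le_trans (ler_norm_sum _ _ _)); apply: ler_sum => l _.
  by rewrite normrM mulrC ler_wpM2l.
rewrite /c mulr_suml.
under eq_bigr => i _ do
  (rewrite exchange_big/=; under eq_bigr => k _ do rewrite exchange_big/=).
rewrite exchange_big/=; apply: ler_sum => k _.
rewrite exchange_big/= mulr_suml; apply: ler_sum => l _.
rewrite /(l1 (f _)) mulr_suml; apply: ler_sum => i _.
by rewrite mulr_suml.
Qed.

Let coef X i j : R^nat := fun k => iter k f X i j / k`!%:R.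

Let coef_diffs X i j : pseries_diffs (coef X i j) = coef (f X) i j.
Proof.
apply/funext => k; rewrite /pseries_diffs /coef -iterSr mulrCA factS natrM.
by rewrite invfM mulVKf ?pnatr_eq0.
Qed.

Let coef_cvg X i j K : cvgn (pseries (coef X i j) K).
Proof.
have c0 : 0 <= c.
  apply: sumr_ge0 => k _; apply: sumr_ge0 => l _.
  by apply: sumr_ge0 => u _; apply: sumr_ge0.
have ik k : l1 (iter k f X) <= c ^+ k * l1 X.
  elim: k => [|k IH]; first by rewrite expr0 mul1r.
  by rewrite iterS (le_trans (l1_le _))// exprS -mulrA ler_wpM2l.
apply: normed_cvg.
apply: (@series_le_cvg _ _ (fun k => l1 X * exp_coeff (c * `|K|) k)).
- by move=> k; apply: normr_ge0.
- move=> k; rewrite mulr_ge0 ?exp_coeff_ge0 ?mulr_ge0//.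
  by apply: sumr_ge0 => u _; apply: sumr_ge0.
- move=> k; rewrite /coef /exp_coeff/= exprMn normrM normrM normrX normfV normr_nat.
  rewrite [leRHS](_ : _ = c ^+ k * l1 X / k`!%:R * `|K| ^+ k); last by ring.
  by rewrite !ler_wpM2r ?exprn_ge0// (le_trans (l1_ge _ _ _)).
- exact/is_cvg_seriesZ/is_cvg_series_exp_coeff.
Qed.

(** The solution is the exponential series applied to [X0], entry by entry: the
    coefficients are entries of f^k X0 / k!, at most a constant times c^k / k!,
    and termwise differentiation shifts k by one, that is, applies [f]. *)
Lemma linear_flow X0 : exists X : R -> 'M[R]_(p, r),
  X 0 = X0 /\ forall t : R, is_derive t 1 X (f (X t)).
Proof.
pose S (X : 'M[R]_(p, r)) t := \matrix_(i, j) limn (pseries (coef X i j) t).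
have fS X t : f (S X t) = S (f X) t.
  apply/matrixP => i j; rewrite fE mxE; apply/esym/cvg_lim => //.
  have -> : pseries (coef (f X) i j) t =
      fun n => \sum_k \sum_l pseries (coef X k l) t n * f (delta_mx k l) i j.
    apply/funext => n; rewrite /pseries /series/=.
    under [RHS]eq_bigr do (under eq_bigr do rewrite mulr_suml; rewrite exchange_big/=).
    rewrite exchange_big/=; apply: eq_bigr => k _.
    rewrite /coef -iterSr iterS fE mulr_suml mulr_suml; apply: eq_bigr => u _.
    rewrite !mulr_suml; apply: eq_bigr => v _; ring.
  apply: cvg_big => [|k _]; first exact: add_continuous.
  apply: cvg_big => [|l _]; first exact: add_continuous.
  apply: cvgMr_tmp.
  by rewrite mxE; exact: coef_cvg.
exists (S X0); split.
  apply/matrixP => i j; rewrite mxE; apply/cvg_lim => //.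
  rewrite -cvg_shiftS; apply: cvg_near_cst; near=> n.
  rewrite /pseries /series/= big_nat_recl//= big1 ?addr0.
    by rewrite /coef expr0 mulr1 divr1.
  by move=> k _; rewrite exprS mul0r mulr0.
move=> t; apply/is_derive_mxP => i j; rewrite fS mxE -coef_diffs.
rewrite (_ : (fun u => _) = fun u => limn (pseries (coef X0 i j) u)); last first.
  by apply/funext => u; rewrite mxE.
apply: (@pseries_snd_diffs _ _ (`|t| + 1)); rewrite ?coef_diffs;
  try exact: coef_cvg.
by rewrite [ltRHS]ger0_norm ?addr_ge0// ltrDl.
Unshelve. all: by end_near. Qed.
End LinearFlow.

End LinearOde.

Local Open Scope complex_scope.
Local Open Scope sesquilinear_scope.

Section Synchronization.
Variable R : realType.
Notation Re := complex.Re.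
Notation Im := complex.Im.

(** * Real trajectories seen through complex coordinates *)

Lemma complex_addcJ (l : R[i]) : l + Num.conj l = (2 * Re l)%:C.
Proof. by rewrite [LHS]addcJ rmorphM rmorph_nat. Qed.

Lemma addcJ_lt0 (l : R[i]) : (l + Num.conj l < 0) = (Re l < 0).
Proof.
rewrite complex_addcJ (_ : (0 : R[i]) = 0%:C)// ltcR.
by rewrite pmulr_rlt0.
Qed.

Lemma hurwitzCP n (M : 'M[R[i]]_n) :
  hurwitzC M <-> forall l, eigenvalue M l -> Re l < 0.
Proof. by split=> hM l /hM; rewrite addcJ_lt0. Qed.

Lemma Re_sum (I : Type) (r : seq I) P (F : I -> R[i]) :
  Re (\sum_(i <- r | P i) F i) = \sum_(i <- r | P i) Re (F i).
Proof.
by rewrite (big_morph (@complex.Re R) (id1 := 0) (op1 := +%R))// => -[a b] [c d].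
Qed.

Lemma Im_sum (I : Type) (r : seq I) P (F : I -> R[i]) :
  Im (\sum_(i <- r | P i) F i) = \sum_(i <- r | P i) Im (F i).
Proof.
by rewrite (big_morph (@complex.Im R) (id1 := 0) (op1 := +%R))// => -[a b] [c d].
Qed.

Lemma ReM (x y : R[i]) : Re (x * y) = Re x * Re y - Im x * Im y.
Proof. by case: x; case: y. Qed.

Lemma ImM (x y : R[i]) : Im (x * y) = Re x * Im y + Im x * Re y.
Proof. by case: x; case: y. Qed.

Lemma Re_mulr (x : R[i]) (y : R) : Re (x * y%:C) = Re x * y.
Proof. by case: x => a b /=; rewrite mulr0 subr0. Qed.

Lemma Im_mulr (x : R[i]) (y : R) : Im (x * y%:C) = Im x * y.
Proof. by case: x => a b /=; rewrite mulr0 add0r. Qed.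

Lemma Re_conjC (x : R[i]) : Re (Num.conj x) = Re x.
Proof. by case: x. Qed.

Lemma Im_conjC (x : R[i]) : Im (Num.conj x) = - Im x.
Proof. by case: x. Qed.

Lemma complexifyM m n p (M : 'M[R]_(m, n)) (N : 'M[R]_(n, p)) :
  complexify (M *m N) = complexify M *m complexify N.
Proof. exact: map_mxM. Qed.

Lemma complexifyD m n (M N : 'M[R]_(m, n)) :
  complexify (M + N) = complexify M + complexify N.
Proof. exact: map_mxD. Qed.

Lemma complexifyB m n (M N : 'M[R]_(m, n)) :
  complexify (M - N) = complexify M - complexify N.
Proof. exact: map_mxB. Qed.

Lemma complexify_conj m n (M : 'M[R]_(m, n)) :
  map_mx Num.conj (complexify M) = complexify M.
Proof. by apply/matrixP => i j; rewrite !mxE; exact: conjc_real. Qed.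

Lemma complexify_adj m n (M : 'M[R]_(m, n)) : (complexify M)^t* = complexify M^T.
Proof. by rewrite -[in RHS]complexify_conj /complexify -!map_trmx. Qed.

Lemma complexify_real m n (M : 'M[R[i]]_(m, n)) :
  map_mx Num.conj M = M -> exists M0, M = complexify M0.
Proof.
move=> MM; exists (map_mx (@complex.Re R) M); apply/matrixP => i j; rewrite !mxE.
have : Num.conj (M i j) = M i j by rewrite -[in RHS]MM mxE.
case: (M i j) => a b [] bb; congr (_ +i* _).
by lra.
Qed.

Lemma bilinearE p r (P : 'rV[R[i]]_p) (Q : 'cV[R[i]]_r) (Y : 'M[R]_(p, r)) :
  (P *m complexify Y *m Q) 0 0 = \sum_l \sum_k (P 0 k * Q l 0) * (Y k l)%:C.
Proof.
rewrite mxE; apply: eq_bigr => l _; rewrite mxE mulr_suml.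
by apply: eq_bigr => k _; rewrite mxE mulrAC.
Qed.

Lemma Re_bilinear p r (P : 'rV[R[i]]_p) (Q : 'cV[R[i]]_r) (Y : 'M[R]_(p, r)) :
  Re ((P *m complexify Y *m Q) 0 0) =
  \sum_l \sum_k Re (P 0 k * Q l 0) * Y k l.
Proof.
rewrite bilinearE Re_sum; apply: eq_bigr => l _; rewrite Re_sum.
by apply: eq_bigr => k _; rewrite Re_mulr.
Qed.

Lemma Im_bilinear p r (P : 'rV[R[i]]_p) (Q : 'cV[R[i]]_r) (Y : 'M[R]_(p, r)) :
  Im ((P *m complexify Y *m Q) 0 0) =
  \sum_l \sum_k Im (P 0 k * Q l 0) * Y k l.
Proof.
rewrite bilinearE Im_sum; apply: eq_bigr => l _; rewrite Im_sum.
by apply: eq_bigr => k _; rewrite Im_mulr.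
Qed.

Lemma is_derive_bilinear p r (P : 'rV[R[i]]_p) (Q : 'cV[R[i]]_r)
    (X : R -> 'M[R]_(p, r)) (t : R) D :
  is_derive t 1 X D ->
  is_derive t 1 (fun u => Re ((P *m complexify (X u) *m Q) 0 0))
                (Re ((P *m complexify D *m Q) 0 0)) /\
  is_derive t 1 (fun u => Im ((P *m complexify (X u) *m Q) 0 0))
                (Im ((P *m complexify D *m Q) 0 0)).
Proof.
move=> /is_derive_mxP XD.
have key (a : 'I_r -> 'I_p -> R) :
    is_derive t 1 (fun u => \sum_l \sum_k a l k * X u k l)
      (\sum_l \sum_k a l k * D k l).
  rewrite (_ : (fun u => _) = \sum_l \sum_k a l k \*: (fun u => X u k l)).
    by apply: is_derive_sum => l; apply: is_derive_sum => k; exact: is_deriveZ.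
  by apply/funext => u; rewrite fct_sumE; apply: eq_bigr => l _; rewrite fct_sumE.
split.
  by rewrite Re_bilinear; under eq_fun do rewrite Re_bilinear; exact: key.
by rewrite Im_bilinear; under eq_fun do rewrite Im_bilinear; exact: key.
Qed.

Definition sqn n (w : 'cV[R[i]]_n) : R :=
  \sum_k (Re (w k 0) ^+ 2 + Im (w k 0) ^+ 2).

Lemma sqn_ge0 n (w : 'cV[R[i]]_n) : 0 <= sqn w.
Proof. by apply: sumr_ge0 => k _; rewrite addr_ge0 ?sqr_ge0. Qed.

Lemma sqnE n (w : 'cV[R[i]]_n) : hform 1%:M w = (sqn w)%:C.
Proof.
by rewrite hform1E rmorph_sum; apply: eq_bigr => k _; rewrite -add_Re2_Im2.
Qed.

(** Here [om] is a mode and [P] a change of coordinates in which the mode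
    evolves by [T]; the derivative of |w|^2 along w' = T w is the form of
    T + adj(T) at w. *)
Lemma is_derive_sqn n N q (T : 'M[R[i]]_q) (P : 'M[R[i]]_(q, n))
    (om : 'cV[R[i]]_N) (X : R -> 'M[R]_(n, N)) (t : R) D :
  is_derive t 1 X D ->
  P *m complexify D *m om = T *m (P *m complexify (X t) *m om) ->
  is_derive t 1 (fun u => sqn (P *m complexify (X u) *m om))
    (Re (hform (T + T^t* ) (P *m complexify (X t) *m om))).
Proof.
move=> XD DE.
pose w u := P *m complexify (X u) *m om.
have wE Y k :
    (P *m complexify Y *m om) k 0 = (row k P *m complexify Y *m om) 0 0.
  by rewrite -!row_mul [RHS]mxE.
pose d k := 2 * (Re (w t k 0) * Re ((T *m w t) k 0) +
                 Im (w t k 0) * Im ((T *m w t) k 0)).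
have -> : Re (hform (T + T^t* ) (w t)) = \sum_k d k.
  rewrite hformD hform_adj complex_addcJ /= /hform -mulmxA mxE Re_sum mulr_sumr.
  apply: eq_bigr => k _; rewrite adjmxE ReM /d; congr (2 * _).
  by rewrite Re_conjC Im_conjC mulNr opprK.
rewrite (_ : (fun u => _) = \sum_k ((fun u => Re (w u k 0)) ^+ 2 +
                                    (fun u => Im (w u k 0)) ^+ 2)).
  apply: is_derive_sum => k; rewrite /d.
  have [dRe dIm] := is_derive_bilinear (row k P) om XD.
  rewrite -wE DE -/(w t) in dRe dIm.
  have dRew : is_derive t 1 (fun u => Re (w u k 0)) (Re ((T *m w t) k 0)).
    rewrite (_ : (fun u => _) =
        fun u => Re ((row k P *m complexify (X u) *m om) 0 0))//.
    by apply/funext => u; rewrite -wE.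
  have dImw : is_derive t 1 (fun u => Im (w u k 0)) (Im ((T *m w t) k 0)).
    rewrite (_ : (fun u => _) =
        fun u => Im ((row k P *m complexify (X u) *m om) 0 0))//.
    by apply/funext => u; rewrite -wE.
  apply: is_derive_eq; rewrite !expr1 /GRing.scale/=.
  by ring.
by apply/funext => u; rewrite fct_sumE.
Qed.

(** Gronwall: expR (d * t) * V t is nonincreasing. *)
Lemma exp_decay (V dV : R -> R) (d : R) : 0 < d ->
  (forall t, 0 <= V t) ->
  (forall t : R, 0 < t -> is_derive t 1 V (dV t)) ->
  (forall t, 0 < t -> dV t <= - d * V t) ->
  V t @[t --> +oo] --> (0 : R).
Proof.
move=> d0 V0 VdV dVle.
pose W t := expR (d * t) * V t.
have WdW t : 0 < t ->
    is_derive (t : R) 1 W (expR (d * t) * (d * V t + dV t)).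
  move=> t0; have VD := VdV t t0; rewrite /W.
  have E : is_derive (t : R) 1 (fun u => expR (d * u)) (d * expR (d * t)).
    have dd : is_derive (t : R) 1 (fun u : R => d * u) d.
      rewrite -[X in is_derive _ _ _ X]mulr1; exact: (is_deriveZ d (is_derive_id t 1)).
    have [dd1 dd2] := dd.
    have dexp : differentiable (@expR R) (d * t) by apply/derivable1_diffP.
    apply: DeriveDef.
      by apply/derivable1_diffP/differentiable_comp => //; exact/derivable1_diffP.
    rewrite -derive1E (_ : (fun u => _) = expR \o (fun u : R => d * u))//.
    rewrite derive1_comp ?derive1E ?dd2 ?derive_val 1?mulrC//.
  apply: is_derive_eq; rewrite /GRing.scale/=; ring.
have Wnincr t : 1 <= t -> W t <= W 1.
  move=> t1.
  apply: (@ler0_derive1_le_cc _ W 1 t) => //; rewrite ?in_itv/= ?lexx ?t1//.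
  - move=> u; rewrite in_itv/= => /andP[u1 _].
    by have [] := WdW u (lt_trans ltr01 u1).
  - move=> u; rewrite in_itv/= => /andP[u1 _].
    have u0 := lt_trans ltr01 u1.
    rewrite derive1E; have [_ ->] := WdW u u0.
    rewrite mulr_ge0_le0 ?expR_ge0// -lerBrDl sub0r -mulNr; exact: dVle.
  - apply: derivable_within_continuous => u; rewrite in_itv/= => /andP[u1 _].
    by have [] := WdW u (lt_le_trans ltr01 u1).
have Vle t : 1 <= t -> V t <= W 1 * expR (- (d * t)).
  move=> t1; rewrite expRN ler_pdivlMr ?expR_gt0// mulrC.
  exact: Wnincr.
apply: (@squeeze_cvgr _ _ _ _ (cst 0) (fun t => W 1 * expR (- (d * t)))).
- near=> t; rewrite V0/=; apply: Vle; near: t; exact: nbhs_pinfty_ge.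
- exact: cvg_cst.
- rewrite -(mulr0 (W 1)); apply: cvgMl_tmp.
  have : d * t @[t --> +oo] --> +oo by apply: gt0_cvgMry.
  move=> dt; exact: (cvg_comp _ _ dt (@cvgr_expR R)).
Unshelve. all: by end_near. Qed.

Lemma cvg0_sqr (g V : R -> R) : (forall t, g t ^+ 2 <= V t) ->
  V t @[t --> +oo] --> (0 : R) -> g t @[t --> +oo] --> (0 : R).
Proof.
move=> gV V0; apply/cvgrPdist_lt => e e0.
have e2 : 0 < e ^+ 2 by rewrite exprn_gt0.
have /cvgrPdist_lt/(_ _ e2) := V0; apply: filterS => t.
rewrite !sub0r !normrN => Vt.
rewrite -(ltr_pXn2r (n := 2)) ?nnegrE// ?(ltW e0)//.
rewrite -normrX ger0_norm ?sqr_ge0// (le_lt_trans (gV t))//.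
by rewrite (le_lt_trans (ler_norm _)).
Qed.

Lemma cvg0_sum n (f : 'I_n -> R -> R) :
  (forall i, f i t @[t --> +oo] --> (0 : R)) ->
  \sum_i f i t @[t --> +oo] --> (0 : R).
Proof.
move=> f0.
have : \sum_i f i t @[t --> +oo] --> \sum_(i < n) (0 : R).
  by apply: cvg_big => [|i _]; [exact: add_continuous|exact: f0].
by rewrite big1.
Qed.

Lemma cvg0_comb (a b : R) (f g : R -> R) :
  f t @[t --> +oo] --> (0 : R) -> g t @[t --> +oo] --> (0 : R) ->
  a * f t + b * g t @[t --> +oo] --> (0 : R).
Proof.
move=> f0 g0.
have : a * f t + b * g t @[t --> +oo] --> a * 0 + b * 0.
  by apply: cvgD; apply: cvgMl_tmp.
by rewrite !mulr0 addr0.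
Qed.

(** In the coordinates where [M] is dissipative, the squared norm of the mode
    decays exponentially. *)
Lemma hurwitz_mode_decay n N (M : 'M[R[i]]_n) (om : 'cV[R[i]]_N)
    (X D : R -> 'M[R]_(n, N)) : hurwitzC M ->
  (forall t : R, 0 < t -> is_derive t 1 X (D t)) ->
  (forall t, 0 < t ->
     complexify (D t) *m om = M *m (complexify (X t) *m om)) ->
  forall k, Re ((complexify (X t) *m om) k 0) @[t --> +oo] --> (0 : R) /\
            Im ((complexify (X t) *m om) k 0) @[t --> +oo] --> (0 : R).
Proof.
move=> /hurwitzC_dissipative[P [d d0 [Pu Td]]] XD DE k.
set T := P *m M *m invmx P in Td.
pose w t := P *m complexify (X t) *m om.
have dE : d = (Re d)%:C.
  by have := ger0_Im (ltW d0); case: (d) => a b /= ->.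
have Vcvg : sqn (w t) @[t --> +oo] --> (0 : R).
  apply: (@exp_decay _ (fun t => Re (hform (T + T^t* ) (w t))) (Re d)).
  - by move: d0; rewrite {1}dE (_ : (0 : R[i]) = 0%:C)// ltcR.
  - by move=> t; exact: sqn_ge0.
  - move=> t t0; apply: (is_derive_sqn (XD t t0)).
    by rewrite /T -!mulmxA mulKmx// DE// !mulmxA.
  - move=> t t0; have := Td (w t); rewrite sqnE dE lecE => /andP[_].
    by rewrite -rmorphN -rmorphM.
have w2 l t : Re (w t l 0) ^+ 2 <= sqn (w t) /\ Im (w t l 0) ^+ 2 <= sqn (w t).
  have : Re (w t l 0) ^+ 2 + Im (w t l 0) ^+ 2 <= sqn (w t).
    rewrite /sqn (bigD1 l)//= lerDl sumr_ge0// => j _.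
    by rewrite addr_ge0 ?sqr_ge0.
  have := sqr_ge0 (Re (w t l 0)); have := sqr_ge0 (Im (w t l 0)).
  by move=> *; split; lra.
have wcvg l : Re (w t l 0) @[t --> +oo] --> (0 : R) /\
              Im (w t l 0) @[t --> +oo] --> (0 : R).
  by split; apply: (cvg0_sqr _ Vcvg) => t; have [] := w2 l t.
have zE t : (complexify (X t) *m om) k 0 = \sum_l invmx P k l * w t l 0.
  by rewrite -[complexify _ *m _](mulKmx Pu) mxE /w !mulmxA.
split.
  rewrite (_ : (fun t => _) = fun t => \sum_l
      (Re (invmx P k l) * Re (w t l 0) + - Im (invmx P k l) * Im (w t l 0))).
    by apply: cvg0_sum => l; apply: cvg0_comb; have [] := wcvg l.
  apply/funext => t; rewrite zE Re_sum; apply: eq_bigr => l _.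
  by rewrite ReM mulNr.
rewrite (_ : (fun t => _) = fun t => \sum_l
    (Re (invmx P k l) * Im (w t l 0) + Im (invmx P k l) * Re (w t l 0))).
  by apply: cvg0_sum => l; apply: cvg0_comb; have [] := wcvg l.
by apply/funext => t; rewrite zE Im_sum; apply: eq_bigr => l _; rewrite ImM.
Qed.

(** * Networks, their modes and the necessity of a stable mode *)

(** With the opposite sign of the usual Laplacian, so that a trajectory is
    driven by A X + H X W^T without minus sign. *)
Definition neg_laplacian N (S : 'M[R]_N) : 'M[R]_N :=
  \matrix_(i, j) (S i j - (\sum_k S i k) *+ (i == j)).

Lemma neg_laplacian_sum N (S : 'M[R]_N) i : \sum_j neg_laplacian S i j = 0.
Proof.
under eq_bigr do rewrite mxE.
rewrite sumrB; set c := \sum_k S i k.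
rewrite (bigD1 i)//= eqxx mulr1n big1 ?addr0 ?subrr// => j ji.
by rewrite eq_sym (negPf ji) mulr0n.
Qed.

(** The diagonal of a matrix with zero row sums is determined by the other
    entries, so dropping it loses nothing. *)
Lemma graph_of_zero_sums N (W : 'M[R]_N) : (forall i, \sum_j W i j = 0) ->
  exists2 S : 'M[R]_N, is_graph S & neg_laplacian S = W.
Proof.
move=> W0; pose S : 'M[R]_N := \matrix_(i, j) (W i j *+ (i != j)).
have S0 i : S i i = 0 by rewrite mxE eqxx.
exists S => //; apply/matrixP => i j; rewrite mxE.
have -> : \sum_k S i k = - W i i.
  rewrite (eq_bigr (fun k => W i k - W i k *+ (i == k))) => [|k _]; last first.
    by rewrite mxE; case: eqP; rewrite ?subrr ?subr0.
  rewrite sumrB W0 sub0r (bigD1 i)//= eqxx mulr1n big1 ?addr0// => k ki.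
  by rewrite eq_sym (negPf ki) mulr0n.
rewrite mxE; case: eqVneq => [<-|ij]; first by rewrite mulr0n mulr1n sub0r opprK.
by rewrite mulr0n subr0.
Qed.

Definition net_field n N (A H : 'M[R]_n) (W : 'M[R]_N) (X : 'M[R]_(n, N)) :=
  A *m X + H *m X *m W^T.

Lemma net_field_is_linear n N (A H : 'M[R]_n) (W : 'M[R]_N) :
  linear (@net_field n N A H W).
Proof.
move=> a X Y; rewrite /net_field !mulmxDr !mulmxDl -!scalemxAr -!scalemxAl.
by rewrite scalerDr addrACA.
Qed.

HB.instance Definition _ n N (A H : 'M[R]_n) (W : 'M[R]_N) :=
  GRing.isLinear.Build R _ _ _ (@net_field n N A H W)
    (@net_field_is_linear n N A H W).

Definition states n N (x : 'I_N -> 'cV[R]_n) : 'M[R]_(n, N) :=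
  \matrix_(k, i) x i k 0.

Lemma col_states n N (x : 'I_N -> 'cV[R]_n) i : col i (states x) = x i.
Proof. by apply/colP => k; rewrite !mxE. Qed.

Lemma net_field_states n m q N (A : 'M[R]_n) (B : 'M[R]_(n, m))
    (C : 'M[R]_(q, n)) (K : 'M[R]_(m, q)) (S : 'M[R]_N) (x : 'I_N -> 'cV[R]_n) i :
  A *m x i + B *m coupling_input C K S x i =
  col i (net_field A (B *m K *m C) (neg_laplacian S) (states x)).
Proof.
rewrite /net_field linearD/= !colE -!mulmxA -!colE col_states; congr (_ + _).
rewrite /coupling_input; congr (_ *m (_ *m _)).
have -> : states x *m col i (neg_laplacian S)^T = \sum_j neg_laplacian S i j *: x j.
  apply/colP => k; rewrite mxE summxE; apply: eq_bigr => j _.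
  by rewrite [LHS]mulrC [in RHS]mxE; congr (_ * _); rewrite mxE// mxE.
under eq_bigr do rewrite scalerBr.
rewrite sumrB -scaler_suml mulmx_sumr.
under [RHS]eq_bigr do rewrite mxE scalerBl linearB/= -!scalemxAr.
rewrite sumrB; congr (_ - _).
set c := \sum_k S i k; rewrite (bigD1 i)//= eqxx mulr1n big1 ?addr0// => j ji.
by rewrite eq_sym (negPf ji) mulr0n scale0r.
Qed.

Lemma trajectory_states n m q N (A : 'M[R]_n) (B : 'M[R]_(n, m))
    (C : 'M[R]_(q, n)) (K : 'M[R]_(m, q)) (S : 'M[R]_N) x :
  network_trajectory A B C K S x -> forall t : R, 0 < t ->
  is_derive t 1 (fun u => states (x^~ u))
    (net_field A (B *m K *m C) (neg_laplacian S) (states (x^~ t))).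
Proof.
move=> xt t t0; apply/is_derive_mxP => k i.
have [_ /(_ t t0)] := xt i; rewrite net_field_states => /is_derive_mxP/(_ k 0).
by rewrite mxE; under [X in _ -> is_derive _ _ X _]eq_fun do rewrite mxE.
Qed.

Lemma network_flow n m q N (A : 'M[R]_n) (B : 'M[R]_(n, m))
    (C : 'M[R]_(q, n)) (K : 'M[R]_(m, q)) (S : 'M[R]_N) (X0 : 'M[R]_(n, N)) :
  exists X : R -> 'M[R]_(n, N), [/\ X 0 = X0,
    network_trajectory A B C K S (fun i t => col i (X t)) &
    forall t : R, is_derive t 1 X
      (net_field A (B *m K *m C) (neg_laplacian S) (X t))].
Proof.
have [X [X0E XD]] :=
  linear_flow (@net_field n N A (B *m K *m C) (neg_laplacian S)) X0.
exists X; split => // i.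
have XiD (t : R) : is_derive t 1 (fun u => col i (X u))
    (col i (net_field A (B *m K *m C) (neg_laplacian S) (X t))).
  apply/is_derive_mxP => k j; rewrite [j]ord1 mxE.
  under eq_fun do rewrite mxE.
  exact: (is_derive_mxP _ _ _).1 (XD t) k i.
split.
  apply: continuous_subspaceT => t; apply: differentiable_continuous.
  by apply/derivable1_diffP; have [] := XiD t.
move=> t _; rewrite net_field_states.
by rewrite (_ : states _ = X t)//; apply/matrixP => k j; rewrite !mxE.
Qed.

(** The mode [om] decouples: its value [X *m om] obeys an equation of its own. *)
Lemma net_field_mode n N (A H : 'M[R]_n) (W : 'M[R]_N) (X : 'M[R]_(n, N))
    (om : 'cV[R[i]]_N) (l : R[i]) :
  complexify W^T *m om = l *: om ->
  complexify (net_field A H W X) *m om =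
  (complexify A + l *: complexify H) *m (complexify X *m om).
Proof.
move=> Wom; rewrite /net_field complexifyD !complexifyM !mulmxDl -!mulmxA Wom.
by rewrite -!scalemxAr -scalemxAl.
Qed.

(** The rows that annihilate the constant vector form a subspace of dimension
    N - 1 > 0, stable under right multiplication by W; it contains an
    eigenvector. *)
Lemma disagreement_mode N (W : 'M[R]_N) : (1 < N)%N ->
  (forall i, \sum_j W i j = 0) ->
  exists (om : 'cV[R[i]]_N) (l : R[i]),
    [/\ om != 0, complexify W^T *m om = l *: om & \sum_i om i 0 = 0].
Proof.
move=> N1 W0; pose one : 'cV[R[i]]_N := const_mx 1.
pose Wc := complexify W; pose V := kermx one.
have Wone : Wc *m one = 0.
  apply/colP => i; rewrite !mxE.
  under eq_bigr do rewrite !mxE mulr1.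
  by rewrite -(rmorph_sum (real_complex R)) W0 rmorph0.
have Vst : stablemx V Wc by apply/sub_kermxP; rewrite -mulmxA Wone mulmx0.
have rV : (0 < \rank V)%N.
  by rewrite mxrank_ker (leq_trans _ (leq_sub2l _ (rank_leq_col _)))// subn_gt0.
have [l /eigenvalueP[u ul u0]] := eigenvalue_closed (conjmx (row_base V) Wc) rV.
have Vst' : stablemx (row_base V) Wc by rewrite stablemx_row_base.
have: (u <= eigenspace (conjmx (row_base V) Wc) l)%MS by apply/eigenspaceP.
rewrite sub_eigenspace_conjmx ?row_base_free// => /eigenspaceP.
set om := u *m row_base V => oml.
exists om^T, l; split.
- rewrite trmx_eq0 -(mul0mx _ (row_base V)).
  by rewrite (inj_eq (row_free_inj (row_base_free V))).
- by rewrite -linearZ/= -oml [RHS]trmx_mul /Wc /complexify map_trmx.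
have : om *m one = 0.
  apply/sub_kermxP; apply: (submx_trans (submxMl _ _)).
  by rewrite eq_row_base.
move=> /matrixP/(_ 0 0); rewrite !mxE => om1; rewrite -[RHS]om1.
by apply: eq_bigr => i _; rewrite !mxE mulr1.
Qed.

Lemma cvg0_entry n k (x : R -> 'cV[R]_n) :
  x t @[t --> +oo] --> (0 : 'cV[R]_n) -> x t k 0 @[t --> +oo] --> (0 : R).
Proof.
move=> x0; have := cvg_comp _ _ x0 (@coord_continuous _ _ _ k 0 0).
by rewrite mxE.
Qed.

Lemma cvg0_vector n (x : R -> 'cV[R]_n) :
  (forall k, x t k 0 @[t --> +oo] --> (0 : R)) ->
  x t @[t --> +oo] --> (0 : 'cV[R]_n).
Proof.
move=> x0.
have : \sum_k x t k 0 *: (delta_mx k 0 : 'cV[R]_n) @[t --> +oo] -->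
       \sum_k (0 : R) *: (delta_mx k 0 : 'cV[R]_n).
  apply: cvg_big => [|k _]; first exact: add_continuous.
  exact: cvgZr_tmp.
rewrite big1 => [|k _]; last by rewrite scale0r.
rewrite (_ : (fun t => \sum_k _) = x)//.
apply/funext => t; rewrite [RHS]matrix_sum_delta.
by apply: eq_bigr => k _; rewrite big_ord1.
Qed.

Lemma cvg0_bilinear p r (P : 'rV[R[i]]_p) (Q : 'cV[R[i]]_r)
    (Y : R -> 'M[R]_(p, r)) :
  (forall k l, Y t k l @[t --> +oo] --> (0 : R)) ->
  Re ((P *m complexify (Y t) *m Q) 0 0) @[t --> +oo] --> (0 : R) /\
  Im ((P *m complexify (Y t) *m Q) 0 0) @[t --> +oo] --> (0 : R).
Proof.
move=> Y0.
have key (a : 'I_r -> 'I_p -> R) :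
    \sum_l \sum_k a l k * Y t k l @[t --> +oo] --> (0 : R).
  apply: cvg0_sum => l; apply: cvg0_sum => k.
  rewrite (_ : (fun t => _) = fun t => a l k * Y t k l + 0 * Y t k l).
    exact: cvg0_comb.
  by apply/funext => t; rewrite mul0r addr0.
split.
  rewrite (_ : (fun t => _) = fun t => \sum_l \sum_k Re (P 0 k * Q l 0) * Y t k l).
    exact: key.
  by apply/funext => t; rewrite Re_bilinear.
rewrite (_ : (fun t => _) = fun t => \sum_l \sum_k Im (P 0 k * Q l 0) * Y t k l).
  exact: key.
by apply/funext => t; rewrite Im_bilinear.
Qed.

(** Otherwise some scalar coordinate zeta = eta X om of a disagreement mode has
    zeta' = mu zeta with Re mu >= 0, so |zeta| cannot decrease to 0. *)
Lemma synchronizes_hurwitz_mode n m q N (A : 'M[R]_n) (B : 'M[R]_(n, m))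
    (C : 'M[R]_(q, n)) (K : 'M[R]_(m, q)) (S : 'M[R]_N) : (1 < N)%N ->
  synchronizes A B C K S ->
  exists l : R[i], hurwitzC (complexify A + l *: complexify (B *m K *m C)).
Proof.
move=> N1 sync.
have [om [l [om0 oml om1]]] := disagreement_mode N1 (neg_laplacian_sum S).
exists l; apply/hurwitzCP => mu /eigenvalueP[eta etamu eta0].
rewrite ltNge; apply/negP => mu0.
have [i0 omi] : exists i, om i 0 != 0.
  apply/existsP; apply: contraR om0; rewrite negb_exists => /forallP om0.
  by apply/eqP/colP => i; have := om0 i; rewrite negbK mxE => /eqP.
have [k0 etak] : exists k, eta 0 k != 0.
  apply/existsP; apply: contraR eta0; rewrite negb_exists => /forallP eta0.
  by apply/eqP/rowP => i; have := eta0 i; rewrite negbK mxE => /eqP.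
(* A real initial state is needed: a single unit entry already makes zeta
   nonzero, namely eta_k0 * om_i0. *)
have [X [X0 Xt XD]] := network_flow A B C K S (delta_mx k0 i0).
pose z u := eta *m complexify (X u) *m om.
have VD (t : R) : is_derive t 1 (fun u => sqn (z u))
    (Re (hform (mu%:M + (mu%:M)^t* ) (z t))).
  apply: (is_derive_sqn (XD t)).
  rewrite -mulmxA (net_field_mode _ _ _ oml) mulmxA etamu mul_scalar_mx.
  by rewrite -scalemxAl mulmxA.
have dV0 t : 0 <= Re (hform (mu%:M + (mu%:M)^t* ) (z t)).
  have -> : mu%:M + (mu%:M)^t* = (2 * Re mu)%:C *: 1%:M :> 'M[R[i]]_1.
    apply/matrixP => i j; rewrite !ord1 -complex_addcJ mxE adjmxE !mxE.
    by rewrite !mulr1n mulr1.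
  rewrite /hform -scalemxAr -scalemxAl mxE -/(hform 1%:M (z t)) sqnE -rmorphM/=.
  by rewrite mulr_ge0 ?sqn_ge0// mulr_ge0.
have Vnd t : 0 <= t -> sqn (z 0) <= sqn (z t).
  move=> t0; apply: (@ger0_derive1_le_cc _ (fun u => sqn (z u)) 0 t) => //.
  - by move=> u _; rewrite derive1E; have [_ ->] := VD u.
  - by apply: derivable_within_continuous => u _; have [] := VD u.
  - by rewrite in_itv/= lexx.
  - by rewrite in_itv/= t0 lexx.
have V0 : 0 < sqn (z 0).
  have : 0 < hform 1%:M (z 0).
    apply: posdef1; apply: contraNneq (mulf_neq0 etak omi) => z0.
    have <- : (z 0) 0 0 = eta 0 k0 * om i0 0; last by rewrite z0 mxE.
    rewrite /z X0 bilinearE (bigD1 i0)//= [X in _ + X]big1 => [|i ii].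
      rewrite addr0 (bigD1 k0)//= [X in _ + X]big1 => [|k kk].
        by rewrite mxE !eqxx mulr1 addr0.
      by rewrite mxE (negPf kk) mulr0.
    by rewrite big1// => k _; rewrite mxE (negPf ii) andbF mulr0.
  by rewrite sqnE (_ : (0 : R[i]) = 0%:C)// ltcR.
pose i1 : 'I_N := Ordinal (ltnW N1).
(* Since the entries of om sum to 0, a reference node can be subtracted. *)
pose Y t : 'M[R]_(n, N) := \matrix_(k, i) (X t k i - X t k i1).
have zY t : z t = eta *m complexify (Y t) *m om.
  rewrite /z -!mulmxA; congr (_ *m _); apply/colP => k; rewrite !mxE.
  under [RHS]eq_bigr do rewrite !mxE rmorphB mulrBl.
  rewrite sumrB -mulr_sumr om1 mulr0 subr0.
  by apply: eq_bigr => i _; rewrite !mxE.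
have [] := @cvg0_bilinear _ _ eta om Y.
  move=> k i; have := cvg0_entry k (sync _ Xt i i1).
  rewrite (_ : (fun t => _) = fun t => Y t k i)//.
  by apply/funext => t; rewrite !mxE.
move=> Re0 Im0.
have : sqn (z t) @[t --> +oo] --> (0 : R).
  rewrite (_ : (fun t => _) =
      fun t => (Re (z t 0 0) ^+ 2 + Im (z t 0 0) ^+ 2)); last first.
    by apply/funext => t; rewrite /sqn big_ord1.
  under eq_fun do rewrite zY.
  under eq_fun do rewrite !expr2.
  rewrite -[0 : R]addr0 -(mulr0 (0 : R)).
  by apply: cvgD; apply: cvgM.
move=> /cvgrPdist_lt/(_ _ V0) Vlt.
near (+oo%R : set_system R) => t.
have : sqn (z t) < sqn (z 0).
  have : `|0 - sqn (z t)| < sqn (z 0) by near: t.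
  by rewrite sub0r normrN ger0_norm ?sqn_ge0.
apply/negP; rewrite -leNgt Vnd//; near: t; exact: nbhs_pinfty_ge.
Unshelve. all: by end_near. Qed.

(** * A weighted graph with a prescribed mode *)

(** The pairing 1-2, 3-4, and so on; node 0 is its own partner. *)
Definition partner N (i : 'I_N.+1) : 'I_N.+1 :=
  inord (if odd i then i.+1 else i.-1).

Lemma partner_even N (i : 'I_N.+1) : odd N.+1 -> ~~ odd i -> (0 < i)%N ->
  odd (partner i) /\ partner (partner i) = i.
Proof.
move=> oN oi i0; have iN := ltn_ord i.
have pi : partner i = i.-1 :> nat by rewrite /partner (negPf oi) inordK; lia.
have opi : odd (partner i) by rewrite pi; lia.
by split=> //; apply: ord_inj; rewrite {1}/partner opi inordK pi; lia.
Qed.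

Lemma partner_odd N (i : 'I_N.+1) : odd N.+1 -> odd i ->
  ~~ odd (partner i) /\ partner (partner i) = i.
Proof.
move=> oN oi; have iN := ltn_ord i.
have pi : partner i = i.+1 :> nat by rewrite /partner oi inordK; lia.
have opi : ~~ odd (partner i) by rewrite pi; lia.
by split=> //; apply: ord_inj; rewrite {1}/partner (negPf opi) inordK pi; lia.
Qed.

Definition deviation N (i : 'I_N.+1) : 'cV[R]_N.+1 :=
  delta_mx i 0 - delta_mx 0 0.

(** The deviations of a pair from node 0 are multiplied by the 2 x 2 real matrix
    of c + i d.  As node 0 is its own partner and has no deviation, its row is 0:
    it is a leader. *)
Definition rotation_weights N (c d : R) : 'M[R]_N.+1 :=
  \matrix_(i, j) (c * deviation i j 0 +
                  (if odd i then - d else d) * deviation (partner i) j 0).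

Lemma deviation_sum N (i : 'I_N.+1) : \sum_j deviation i j 0 = 0.
Proof.
have delta_sum k : \sum_(j < N.+1) (j == k)%:R = 1 :> R.
  by rewrite (bigD1 k)//= eqxx big1 ?addr0// => j /negPf ->.
under eq_bigr do rewrite !mxE !andbT.
by rewrite sumrB !delta_sum subrr.
Qed.

Lemma deviation0 N : deviation (0 : 'I_N.+1) = 0.
Proof. by rewrite /deviation subrr. Qed.

Lemma rotation_weights_sum N c d (i : 'I_N.+1) :
  \sum_j rotation_weights N c d i j = 0.
Proof.
under eq_bigr do rewrite mxE.
by rewrite big_split/= -!mulr_sumr !deviation_sum !mulr0 addr0.
Qed.

Lemma rotation_weights_deviation N c d (i : 'I_N.+1) :
  (rotation_weights N c d)^T *m deviation i =
  c *: deviation i + (if odd i then - d else d) *: deviation (partner i).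
Proof.
have row_dev j : col j (rotation_weights N c d)^T =
    c *: deviation j + (if odd j then - d else d) *: deviation (partner j).
  by apply/colP => k; rewrite !mxE.
rewrite {1}/deviation mulmxBr -!colE !row_dev/= deviation0 scaler0 add0r.
have -> : partner (0 : 'I_N.+1) = 0.
  by apply: ord_inj; rewrite /partner/= inordK.
by rewrite deviation0 scaler0 subr0.
Qed.

Lemma rotation_weights_mode N c d (i : 'I_N.+1) (om := complexify (deviation i) +
     'i *: complexify (deviation (partner i))) : odd N.+1 -> odd i ->
  complexify (rotation_weights N c d)^T *m om = (c +i* d) *: om.
Proof.
move=> oN oi; have [opi ppi] := partner_odd oN oi.
rewrite /om mulmxDr -scalemxAr -!complexifyM !rotation_weights_deviation oi.
rewrite (negPf opi) ppi; apply/colP => k; rewrite !mxE.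
set a := _ - _; set b := _ - _.
by apply/eqP; rewrite eq_complex/=; apply/andP; split; apply/eqP; ring.
Qed.

(** Every node but the leader belongs to a pair, because N is odd, and the
    deviations of a pair are the real and imaginary parts of one complex mode. *)
Lemma hurwitz_synchronizable n m q N (A : 'M[R]_n) (B : 'M[R]_(n, m))
    (C : 'M[R]_(q, n)) (K : 'M[R]_(m, q)) (l : R[i]) : odd N ->
  hurwitzC (complexify A + l *: complexify (B *m K *m C)) ->
  exists2 S : 'M[R]_N, is_graph S & synchronizes A B C K S.
Proof.
case: N => // N oN hM.
have [S Sg SW] := graph_of_zero_sums (@rotation_weights_sum N (Re l) (Im l)).
exists S => // x xt.
have oddP (i : 'I_N.+1) k : odd i ->
    (x i t - x 0 t) k 0 @[t --> +oo] --> (0 : R) /\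
    (x (partner i) t - x 0 t) k 0 @[t --> +oo] --> (0 : R).
  move=> oi; pose om := complexify (deviation i) +
    'i *: complexify (deviation (partner i)).
  have omE : complexify (neg_laplacian S)^T *m om = l *: om.
    by rewrite SW rotation_weights_mode//; case: (l).
  have devE j t : (states (x^~ t) *m deviation j) k 0 = (x j t - x 0 t) k 0.
    by rewrite /deviation mulmxBr -!colE !col_states.
  have [] := hurwitz_mode_decay hM (trajectory_states xt)
    (fun t _ => net_field_mode A (B *m K *m C) (states (x^~ t)) omE) k.
  have zE t : (complexify (states (x^~ t)) *m om) k 0 =
      (x i t - x 0 t) k 0 +i* (x (partner i) t - x 0 t) k 0.
    rewrite /om mulmxDr -scalemxAr -!complexifyM mxE [X in _ + X]mxE.
    rewrite ![complexify _ k 0]mxE !devE.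
    by apply/eqP; rewrite eq_complex/=; apply/andP; split; apply/eqP; ring.
  by under eq_fun do rewrite zE;
    under [X in _ -> X @ _ --> _ -> _]eq_fun do rewrite zE.
have x0 i : x i t - x 0 t @[t --> +oo] --> (0 : 'cV[R]_n).
  apply: cvg0_vector => k.
  have [oi|ei] := boolP (odd i); first by have [] := oddP i k oi.
  have [i0|i0] := posnP i.
    have -> : i = 0 by apply: ord_inj.
    by under eq_fun do rewrite subrr mxE; exact: cvg_cst.
  have [opi ppi] := partner_even oN ei i0.
  by have [_] := oddP _ k opi; rewrite ppi.
move=> i j.
rewrite (_ : (fun t => _) = fun t => (x i t - x 0 t) - (x j t - x 0 t)).
  by rewrite -[0 : 'cV[R]_n]subr0; apply: cvgB.
by apply/funext => t; rewrite opprB addrA subrK.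
Qed.

(** * From one stable mode to the algebraic conditions and back *)

Lemma hurwitzC_tr n (M : 'M[R[i]]_n) : hurwitzC M -> hurwitzC M^T.
Proof.
have chM : char_poly M^T = char_poly M.
  rewrite /char_poly -det_tr; congr (\det _).
  by apply/matrixP => i j; rewrite !mxE eq_sym.
by move=> hM l; rewrite eigenvalue_root_char chM -eigenvalue_root_char => /hM.
Qed.

Lemma stabilizable_complex n m (A : 'M[R]_n) (B : 'M[R]_(n, m))
    (G : 'M[R[i]]_(m, n)) :
  hurwitzC (complexify A - complexify B *m G) -> stabilizable A B.
Proof.
move=> /(real_stabilizing_feedback (complexify_conj A) (complexify_conj B)).
move=> [F FF hF].
have [F0 F0E] := complexify_real FF.
exists F0; move: hF => /hurwitzCP.
by rewrite F0E -complexifyM -complexifyB.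
Qed.

Lemma detectable_eigen n q (A : 'M[R]_n) (C : 'M[R]_(q, n))
    (v : 'cV[R[i]]_n) l :
  detectable A C -> v != 0 -> complexify A *m v = l *: v ->
  complexify C *m v = 0 -> Re l < 0.
Proof.
move=> [F hF] v0 Av Cv; apply: hF; apply/eigenvalueP.
exists v^T; last by rewrite trmx_eq0.
rewrite complexifyB complexifyM mulmxBr /complexify -!map_trmx mulmxA -!trmx_mul.
by rewrite -/(complexify A) -/(complexify C) Av Cv trmx0 mul0mx subr0 linearZ.
Qed.

(** The feedback enters [M] through C, so on the kernel of C the eigenvectors of
    [M] are eigenvectors of A.  For an eigenvalue with nonnegative real part the
    equation is a vanishing sum of nonnegative terms, one of them |C v|^2. *)
Lemma lyapunov_detectable_hurwitz n m q (A : 'M[R]_n) (C : 'M[R]_(q, n))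
    (K : 'M[R]_(m, q)) (G : 'M[R[i]]_(n, q)) (P : 'M[R[i]]_n)
    (M := complexify A - G *m complexify C) :
  detectable A C -> possemidef P ->
  M^t* *m P + P *m M + complexify (C^T *m C) +
    complexify (C^T *m K^T *m K *m C) = 0 ->
  hurwitzC M.
Proof.
move=> dAC Pp ME; rewrite -[M]trmxK; apply: hurwitzC_tr => l /eigenvalueP[u ul u0].
pose v := u^T; have v0 : v != 0 by rewrite trmx_eq0.
have Mv : M *m v = l *: v by rewrite -linearZ/= -ul trmx_mul trmxK.
rewrite addcJ_lt0 ltNge; apply/negP => l0.
have ll0 : 0 <= l + l^*.
  by rewrite complex_addcJ (_ : (0 : R[i]) = 0%:C)// lecR mulr_ge0.
have gram p (Z : 'M[R]_(p, n)) :
    hform (complexify (Z^T *m Z)) v = hform 1%:M (complexify Z *m v).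
  by rewrite complexifyM -complexify_adj -[X in X *m _]mulmx1 hform_congr.
have lv : hform (M^t* *m P) v + hform (P *m M) v = (l + l^* ) * hform P v.
  by rewrite -hformD -[X in P *m X]trmxCK; apply: hform_eigen; rewrite trmxCK.
have := congr1 (fun Z => hform Z v) ME.
rewrite (_ : C^T *m K^T *m K *m C = (K *m C)^T *m (K *m C)); last first.
  by rewrite trmx_mul !mulmxA.
rewrite !hformD lv !gram [hform 0 v]/hform mulmx0 mul0mx mxE => /eqP.
rewrite paddr_eq0 ?addr_ge0 ?hform1_ge0 ?mulr_ge0 ?Pp// => /andP[].
rewrite paddr_eq0 ?hform1_ge0 ?mulr_ge0 ?Pp// => /andP[_ Cv0] _.
have Cv : complexify C *m v = 0.
  by apply: contraTeq Cv0 => /posdef1 Cv; rewrite gt_eqF.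
suff : Re l < 0 by rewrite ltNge l0.
apply: (detectable_eigen dAC v0 _ Cv).
by rewrite -Mv /M mulmxBl -mulmxA Cv mulmx0 subr0.
Qed.

Lemma hurwitz_lyapunov n p (M : 'M[R[i]]_n) (Z : 'M[R]_(p, n)) : hurwitzC M ->
  exists P, hermitian_psd P /\ lyapunov M P = - complexify (Z^T *m Z).
Proof.
move=> hM; pose Q := complexify (Z^T *m Z).
have QE : Q = (complexify Z)^t* *m 1%:M *m complexify Z.
  by rewrite mulmx1 complexify_adj -complexifyM.
have [||P [Ph Pp PE]] := lyapunov_hurwitz (Q := Q) hM.
- by rewrite /Q complexify_adj trmx_mul trmxK.
- by move=> v; rewrite QE hform_congr hform1_ge0.
by exists P; split=> //; split=> //; apply/hermsymmxP.
Qed.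

(** Both constant terms come from one real matrix, so that a single Lyapunov
    equation with a Gram matrix on the right covers them. *)
Lemma col_mx_gram n m q (C : 'M[R]_(q, n)) (K : 'M[R]_(m, q)) :
  (col_mx C (K *m C))^T *m col_mx C (K *m C) = C^T *m C + C^T *m K^T *m K *m C.
Proof. by rewrite tr_col_mx mul_row_col trmx_mul !mulmxA. Qed.

End Synchronization.

Theorem theorem4 (R : realType) (n m q N : nat)
    (A : 'M[R]_n) (B : 'M[R]_(n, m)) (C : 'M[R]_(q, n))
    (N_gt1 : (1 < N)%N) (N_odd : odd N) :
  output_feedback_synchronizable N A B C <->
  [/\ stabilizable A B,
      detectable A C &
      exists (K : 'M[R]_(m, q)) (s : R[i]) (P : 'M[R[i]]_n),
        hermitian_psd P /\
        let Acl := complexify A - s *: complexify (B *m K *m C) in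
        Acl ^t* *m P + P *m Acl + complexify (C^T *m C)
          + complexify (C^T *m K^T *m K *m C) = 0].
Proof.
have BKC K (s : R[i]) : s *: complexify (B *m K *m C) =
    s *: complexify (B *m K) *m complexify C.
  by rewrite complexifyM -scalemxAl.
split=> [[K [S [_ /(synchronizes_hurwitz_mode N_gt1)[l hM]]]]|[_ dAC]].
  have {}hM : hurwitzC (complexify A - (- l) *: complexify (B *m K *m C)).
    by rewrite scaleNr opprK.
  split.
  - apply: (@stabilizable_complex _ _ _ _ _ (- l *: complexify (K *m C))).
    by rewrite -scalemxAr -complexifyM mulmxA.
  - apply: (@stabilizable_complex _ _ _ _ _ (- l *: complexify (B *m K)^T)).
    rewrite -scalemxAr -complexifyM -trmx_mul /complexify -!map_trmx.
    by rewrite -linearZ -linearB; exact: hurwitzC_tr.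
  - have [P [Pp PE]] := hurwitz_lyapunov (col_mx C (K *m C)) hM.
    exists K, (- l), P; split=> //=.
    rewrite -addrA -complexifyD -col_mx_gram -[_ + P *m _]/(lyapunov _ P).
    by rewrite PE addNr.
move=> [K [s [P [[_ Pp] /= PE]]]].
have [] := @hurwitz_synchronizable _ _ _ _ N A B C K (- s) N_odd.
  rewrite scaleNr BKC.
  apply: (lyapunov_detectable_hurwitz (K := K) (P := P) dAC) => //.
  by rewrite -BKC.
by move=> S Sg Ss; exists K, S.
Qed.
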